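(* Let $G$ be a convex compact visibility graph. Then every edge of $G$ is either a bridge of $G$ or lies in a triangle ($K_3$) of $G$.
   Context: All graphs are finite and simple. Given a family of pairwise disjoint nonempty connected subsets (''regions'') of $\mathbb{R}^2$, a sightline is a closed line segment $\overline{ab}$ with $a\in A$, $b\in B$ for two different regions $A\neq B$ of the family, such that the segment intersects no region of the family other than $A$ and $B$. A graph $G$ is a visibility graph if there is a family of pairwise disjoint nonempty connected subsets of $\mathbb{R}^2$, one for each vertex of $G$ (a visibility representation), such that two distinct vertices are adjacent in $G$ if and only if there is a sightline between their regions. $G$ is a convex compact visibility graph if it has such a representation in which every region is compact and convex. A bridge is an edge whose removal increases the number of connected components. *)

(* Defs.v *)
From HB Require Import structures.
From mathcomp Require Import all_boot all_order all_algebra.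
From mathcomp Require Import all_classical all_reals all_analysis.
From mathcomp Require Import Rstruct Rstruct_topology.
Set Implicit Arguments. Unset Strict Implicit. Unset Printing Implicit Defensive.
Import Order.TTheory GRing.Theory Num.Theory.
Local Open Scope classical_set_scope.
Local Open Scope ring_scope.

Notation point := (Rdefinitions.R * Rdefinitions.R)%type.

Definition segment (a b : point) : set point :=
  [set p | exists t : Rdefinitions.R, 0 <= t <= 1 /\
     p = ((1 - t) * a.1 + t * b.1, (1 - t) * a.2 + t * b.2)].

Definition convex_set2 (A : set point) : Prop :=
  forall a b, A a -> A b -> segment a b `<=` A.

Definition cc_visibility_rep (T : finType) (e : rel T) (reg : T -> set point) : Prop :=
  (forall x, reg x !=set0) /\
  (forall x, connected (reg x)) /\
  (forall x, compact (reg x)) /\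
  (forall x, convex_set2 (reg x)) /\
  (forall x y, x != y -> reg x `&` reg y = set0) /\
  (forall x y, x != y ->
         (e x y <-> exists a b, reg x a /\ reg y b /\
             forall z, z != x -> z != y -> segment a b `&` reg z = set0)).

Definition convex_compact_visibility_graph (T : finType) (e : rel T) : Prop :=
  exists reg : T -> set point, cc_visibility_rep e reg.

Definition remove_edge (T : finType) (e : rel T) (u v : T) : rel T :=
  fun x y => e x y && ~~ (((x == u) && (y == v)) || ((x == v) && (y == u))).

Definition num_components (T : finType) (e : rel T) : nat := n_comp (connect e) T.

Definition is_bridge (T : finType) (e : rel T) (u v : T) : Prop :=
  e u v /\ (num_components e < num_components (remove_edge e u v))%N.

(* Main.v *)
Require Import Defs.
From mathcomp Require Import all_boot all_order all_algebra.
From mathcomp Require Import all_classical all_reals all_analysis.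
From mathcomp Require Import Rstruct Rstruct_topology.
From mathcomp Require Import ring lra.

(** Let uv be an edge with regions U, V, and let O be the union of the other regions. If some
    point w of O has half-open segments ]w, a] and ]w, b] with a in U, b in V such that both
    avoid O, the first avoids V and the second avoids U, then w's region forms a triangle with u, v.

    If some segment between U and V is blocked by O, slide one endpoint of a free segment
    until it first hits O: the hit nearest the fixed endpoint is such a w.

    Otherwise no other region meets the segments between U and V. Call w "behind U" when every
    segment from w to V meets U. If w in O is behind neither U nor V, take a common tangent
    ab of U and V separating them from w: the point of O in the triangle wab closest to ab sees
    both. So without triangles every point of O is behind U or behind V; a segment avoiding U and
    V cannot join a point behind U to one behind V, hence the regions behind U together
    with U are linked to the rest only by uv, which is therefore a bridge. *)

Set Implicit Arguments. Unset Strict Implicit. Unset Printing Implicit Defensive.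

(** * Components and bridges of finite graphs *)

(** Serves to unfold [num_components], which hands [connect e] rather than [e] to [n_comp]. *)
Lemma connect_connect (T : finType) (e : rel T) : connect (connect e) =2 connect e.
Proof.
move=> x y; apply/idP/idP; last exact: connect1.
exact: (connect_sub (fun _ _ => id)).
Qed.

(** Sending each root of [e] to its [e']-root is injective. Were it onto, every vertex would share
    its [e']-root with its [e]-root, and [u], [v] would be joined in [e']. *)
Lemma n_comp_subrel_lt (T : finType) (e e' : rel T) u v :
  connect_sym e -> connect_sym e' -> subrel e' e ->
  e u v -> ~~ connect e' u v -> (n_comp e T < n_comp e' T)%N.
Proof.
move=> se se' sub euv nuv.
have sub' : subrel (connect e') (connect e).
  by apply: connect_sub => x y /sub; exact: connect1.
pose A : {set T} := [set x | roots e x]; pose B : {set T} := [set x | roots e' x].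
have -> : n_comp e T = #|A| by apply: eq_card => x; rewrite !inE andbT.
have -> : n_comp e' T = #|B| by apply: eq_card => x; rewrite !inE andbT.
have rr x : fingraph.root e (fingraph.root e' x) = fingraph.root e x.
  by apply/esym/(fingraph.rootP se)/sub'; exact: connect_root.
have inj : {in A &, injective (fingraph.root e')}.
  move=> x y; rewrite !inE => /eqP rx /eqP ry xy.
  by rewrite -rx -ry -(rr x) xy rr.
rewrite -(card_in_imset inj); apply: proper_card; rewrite properE.
apply/andP; split.
  by apply/fintype.subsetP => _ /imsetP[x _ ->]; rewrite inE roots_root.
apply/negP => /fintype.subsetP BA.
have same x : fingraph.root e' x = fingraph.root e' (fingraph.root e x).
  have /BA/imsetP[y] : fingraph.root e' x \in B by rewrite inE roots_root.
  by rewrite inE => /eqP yA E; rewrite E; congr fingraph.root; rewrite -rr E rr.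
move/negP: nuv; apply; apply/(fingraph.rootP se'); rewrite same [RHS]same; congr fingraph.root.
by apply/(fingraph.rootP se)/connect1.
Qed.

(** Once [uv] is deleted no edge leaves [S], so [u] and [v] fall into different components. *)
Lemma bridge_of_cut (T : finType) (e : rel T) (S : pred T) u v :
  symmetric e -> e u v -> S u -> ~~ S v ->
  (forall x y, e x y -> S x -> ~~ S y -> x = u /\ y = v) -> is_bridge e u v.
Proof.
move=> se euv Su Sv cut; split=> //.
set e' := remove_edge e u v.
have se' : symmetric e'.
  move=> x y; rewrite /e' /remove_edge se; congr (_ && ~~ _).
  by rewrite orbC; congr (_ || _); rewrite andbC.
have closedS : fingraph.closed e' S.
  have half x y : e' x y -> S x -> S y.
    move=> /andP[exy nxy] Sx; apply: contraNT nxy => nSy.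
    by have [-> ->] := cut _ _ exy Sx nSy; rewrite !eqxx.
  by move=> x y exy; apply/idP/idP; apply: half => //; rewrite se'.
rewrite /num_components !(eq_n_comp (@connect_connect _ _)).
apply: (n_comp_subrel_lt _ _ _ euv) => //; try exact: sym_connect_sym.
  by move=> x y /andP[].
by apply/negP => /(closed_connect closedS); rewrite !unfold_in Su (negbTE Sv).
Qed.

Import Order.TTheory GRing.Theory Num.Theory.
Import numFieldNormedType.Exports.
Local Open Scope classical_set_scope.
Local Open Scope ring_scope.

Local Notation R := Rdefinitions.R.
Local Notation plane := Defs.point.

(** * Affine coordinates on segments and triangles *)

Definition lerp (a b : plane) (t : R) : plane :=
  ((1 - t) * a.1 + t * b.1, (1 - t) * a.2 + t * b.2).

Definition bary (p a b : plane) (x y : R) : plane :=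
  ((1 - x - y) * p.1 + x * a.1 + y * b.1, (1 - x - y) * p.2 + x * a.2 + y * b.2).

Lemma cone_bary p a b t s :
  lerp p (lerp a b t) s = bary p a b (s * (1 - t)) (s * t).
Proof. by rewrite /lerp /bary; congr pair => /=; ring. Qed.

Lemma bary_bary p a b x1 y1 x2 y2 x y :
  bary p (bary p a b x1 y1) (bary p a b x2 y2) x y =
  bary p a b (x * x1 + y * x2) (x * y1 + y * y2).
Proof. by rewrite /bary; congr pair => /=; ring. Qed.

Lemma lerp0 a b : lerp a b 0 = a.
Proof. by rewrite [RHS]surjective_pairing /lerp; congr pair; ring. Qed.

Lemma lerp1 a b : lerp a b 1 = b.
Proof. by rewrite [RHS]surjective_pairing /lerp; congr pair; ring. Qed.

Lemma lerpxx a t : lerp a a t = a.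
Proof. by rewrite [RHS]surjective_pairing /lerp; congr pair; ring. Qed.

Lemma lerp_sym a b t : lerp a b t = lerp b a (1 - t).
Proof. by rewrite /lerp; congr pair; ring. Qed.

Lemma lerp_lerpr a b s t : lerp a (lerp a b s) t = lerp a b (t * s).
Proof. by rewrite /lerp; congr pair => /=; ring. Qed.

Lemma lerp_lerpl a b s t : lerp (lerp a b s) b t = lerp a b ((1 - t) * s + t).
Proof. by rewrite /lerp; congr pair => /=; ring. Qed.

(** Projection from [p] onto the side [ab]: [s] is [x + y] and [t] is [y / (x + y)], with [t = 0]
    chosen at the apex. *)
Lemma bary_cone p a b x y : 0 <= x -> 0 <= y -> x + y <= 1 ->
  exists t s, [/\ 0 <= t <= 1, 0 <= s <= 1, s * (1 - t) = x, s * t = y &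
                  bary p a b x y = lerp p (lerp a b t) s].
Proof.
move=> x0 y0 xy1; have [s0|s_neq0] := eqVneq (x + y) 0.
  exists 0, 0; have [-> ->] : x = 0 /\ y = 0 by split; lra.
  by split; rewrite ?cone_bary; try congr bary; lra.
have s_gt0 : 0 < x + y by rewrite lt_def s_neq0; lra.
have e1 : (x + y) * (1 - y / (x + y)) = x by field.
have e2 : (x + y) * (y / (x + y)) = y by field.
exists (y / (x + y)), (x + y); split => //.
- by apply/andP; split; [apply: divr_ge0; lra | rewrite ler_pdivrMr //; lra].
- by lra.
- by rewrite cone_bary e1 e2.
Qed.

Lemma convex_lerp A a b t : convex_set2 A -> A a -> A b -> 0 <= t <= 1 -> A (lerp a b t).
Proof. by move=> cA Aa Ab t01; apply: (cA a b) => //; exists t. Qed.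

Lemma convex_lerp_le A a b s t : convex_set2 A -> A a -> A (lerp a b s) ->
  0 <= t -> t <= s -> A (lerp a b t).
Proof.
move=> cA Aa Abs t0 ts; have [s0|s_neq0] := eqVneq s 0.
  by have -> : t = 0 by [lra]; rewrite lerp0.
have s_gt0 : 0 < s by rewrite lt_def s_neq0; lra.
have -> : lerp a b t = lerp a (lerp a b s) (t / s) by rewrite lerp_lerpr divfK.
apply: convex_lerp => //; apply/andP; split; first by apply: divr_ge0; lra.
by rewrite ler_pdivrMr //; lra.
Qed.

(** * Continuity and minimisation over a triangle *)

Lemma cone_coordinate_continuous (K : realType) (c d e : K) :
  continuous (fun x : K * K => (1 - x.2) * c + x.2 * ((1 - x.1) * d + x.1 * e)).
Proof.
move=> x.
have c1 : fst @ x --> x.1 by exact: cvg_fst.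
have c2 : snd @ x --> x.2 by exact: cvg_snd.
apply: cvgD; first by apply: cvgMr_tmp; apply: cvgB c2; exact: cvg_cst.
apply: cvgM => //; apply: cvgD; apply: cvgMr_tmp => //.
by apply: cvgB c1; exact: cvg_cst.
Qed.

Lemma cone_continuous p a b :
  continuous (fun x : plane => lerp p (lerp a b x.1) x.2).
Proof.
move=> x; have c := @cone_coordinate_continuous R.
exact: (cvg_pair (c _ _ _ x) (c _ _ _ x)).
Qed.

(** The triangle is a continuous image of the unit square, so the parameters of its points in [K]
    form a compact set. The objective is a function of the parameters, not of the point. *)
Lemma cone_min p a b (K : set plane) (f : plane -> R) :
  closed K -> continuous f ->
  (exists t s, [/\ 0 <= t <= 1, 0 <= s <= 1 & K (lerp p (lerp a b t) s)]) ->
  exists t s, [/\ 0 <= t <= 1, 0 <= s <= 1, K (lerp p (lerp a b t) s) &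
    forall t' s', 0 <= t' <= 1 -> 0 <= s' <= 1 -> K (lerp p (lerp a b t') s') ->
      f (t, s) <= f (t', s')].
Proof.
move=> cK cf [t0 [s0 [t001 s001 K0]]].
pose Q : set plane := `[0, 1] `*` `[0, 1].
pose C := Q `&` (fun x : plane => lerp p (lerp a b x.1) x.2) @^-1` K.
have CE t s : (t, s) \in C <-> [/\ 0 <= t <= 1, 0 <= s <= 1 & K (lerp p (lerp a b t) s)].
  rewrite inE /C /Q /=; split.
    by move=> [[]] /=; rewrite !in_itv /=.
  by move=> [? ? ?]; split=> //; split; rewrite /= in_itv.
have cC : compact C.
  apply: compact_closedI; last first.
    by move/continuous_closedP: (@cone_continuous p a b); apply.
  by apply: compact_setX; exact: segment_compact.
have [||[t s] /CE[t01 s01 Kts] mts] := @compact_EVT_min _ _ f C _ cC.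
- by exists (t0, s0); apply/set_mem/CE.
- exact: continuous_subspaceT.
by exists t, s; split=> // t' s' t'01 s'01 Kts'; apply: mts; apply/CE.
Qed.

(* In the coordinates x = s (1 - t), y = s t of [bary_cone], this is the linear form x + r y. *)
Lemma weight_continuous (K : realType) (r : K) :
  continuous (fun x : K * K => x.2 * (1 - x.1 + r * x.1)).
Proof.
move=> x.
have c1 : fst @ x --> x.1 by exact: cvg_fst.
have c2 : snd @ x --> x.2 by exact: cvg_snd.
apply: cvgM => //; apply: cvgD; last exact: cvgMl_tmp.
by apply: cvgB c1; exact: cvg_cst.
Qed.

Lemma fst_snd_continuous (K : realType) :
  continuous (fun x : K * K => x.1 * x.2).
Proof. by move=> x; apply: cvgM; [exact: cvg_fst | exact: cvg_snd]. Qed.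

Lemma opp_fst_continuous (K : realType) : continuous (fun x : K * K => - x.1).
Proof. by move=> x; apply: cvgN; exact: cvg_fst. Qed.

Lemma opp_snd_continuous (K : realType) : continuous (fun x : K * K => - x.2).
Proof. by move=> x; apply: cvgN; exact: cvg_snd. Qed.

(** Exchanging [x] and [y] turns the one-sided bound into a two-sided one, which gives
    continuity. *)
Lemma lipschitz_IVT (K : realType) (f : K -> K) (a b k : K) :
  (forall x y, f x - f y <= k * `|x - y|) -> a <= b -> f a <= 0 -> 0 <= f b ->
  exists2 c, a <= c & f c = 0.
Proof.
move=> fk ab fa fb.
have cf : continuous f.
  move=> x; apply/cvgrPdist_lt => e e0; near=> y.
  have k0 : 0 < `|k| + 1 by rewrite ltr_wpDl.
  have : `|x - y| < e / (`|k| + 1).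
    by near: y; apply: cvgr_dist_lt; rewrite ?divr_gt0 //; exact: cvg_id.
  rewrite ltr_pdivlMr // => h; apply: le_lt_trans h.
  have kk : k * `|x - y| <= `|x - y| * (`|k| + 1).
    rewrite mulrC ler_wpM2l //; apply: le_trans (ler_norm k) _; lra.
  have := fk x y; have := fk y x; rewrite (distrC y x) => h1 h2.
  by rewrite ler_norml; apply/andP; split; lra.
have [||c] := @IVT K f a b 0 ab; last by rewrite in_itv /= => /andP[? _] ?; exists c.
- exact: continuous_subspaceT.
- by rewrite ge_min fa le_max fb orbT.
Unshelve. all: by end_near.
Qed.

(** * Points behind U against points behind V *)

(* Take b in V and the triangle p q b, with b as close as possible to the side pq: going from b
   towards p hits U, and from there towards q hits V strictly closer to pq. *)
Lemma behind_crossing (U V : set plane) p q b0 :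
  closed V -> U `&` V = set0 -> V b0 ->
  (forall b, V b -> exists2 t, 0 <= t <= 1 & U (lerp p b t)) ->
  (forall a, U a -> exists2 t, 0 <= t <= 1 & V (lerp q a t)) ->
  (forall t, 0 <= t <= 1 -> ~ V (lerp p q t)) -> False.
Proof.
move=> cV UV Vb0 pU qV pqV.
have [|l [s [/[dup] l01 /andP[l0 l1] /andP[s0 s_le1] Vb mb]]] :=
    @cone_min b0 p q V _ cV (@opp_snd_continuous R).
  by exists 0, 0; split; rewrite ?lerp0 //; lra.
have s1 : s < 1.
  case: (ltP s 1) => // s1; case: (pqV l) => //.
  by have -> : lerp p q l = lerp b0 (lerp p q l) s by [have -> : s = 1 by [lra]; rewrite lerp1].
have [t1 /andP[t10 t11] Ua] := pU _ Vb.
have [t2 /andP[t20 t21] Vb'] := qV _ Ua.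
have eqb' : lerp q (lerp p (lerp b0 (lerp p q l) s) t1) t2 =
  bary b0 p q (t2 * ((1 - t1) + t1 * (s * (1 - l)))) (1 - t2 + t2 * (t1 * (s * l))).
  by rewrite /lerp /bary; congr pair => /=; ring.
have [||| t' [s' [t'01 s'01 ex ey eb]]] := @bary_cone b0 p q
   (t2 * ((1 - t1) + t1 * (s * (1 - l)))) (1 - t2 + t2 * (t1 * (s * l))).
- by apply: mulr_ge0 t20 (addr_ge0 _ (mulr_ge0 t10 (mulr_ge0 s0 _))); lra.
- by have := mulr_ge0 t20 (mulr_ge0 t10 (mulr_ge0 s0 l0)); lra.
- have : 0 <= t2 * t1 * (1 - s) by apply: mulr_ge0 (mulr_ge0 t20 t10) _; lra.
  by lra.
have := mb _ _ t'01 s'01; rewrite -eb -eqb' => /(_ Vb') /= mss.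
(* The distance to [pq], measured by [1 - s], gets multiplied by [t1] and then by [t2]. Maximality
   of [s] forces [t1 = 1], so the hit of U is the chosen point of V itself. *)
have es' : s' = 1 - t2 * t1 * (1 - s) by lra.
have t12 : (1 - t2 * t1) * (1 - s) <= 0 by lra.
rewrite pmulr_lle0 in t12; last by lra.
have t1E : t1 = 1 by have : 0 <= (1 - t2) * t1 by [apply: mulr_ge0; lra]; lra.
have : (U `&` V) (lerp b0 (lerp p q l) s) by split=> //; move: Ua; rewrite t1E lerp1.
by rewrite UV.
Qed.

(** * Points of O that see both regions *)

Definition sees_both (U V O : set plane) := exists w a b,
  [/\ O w, U a, V b,
      forall t, 0 < t <= 1 -> ~ O (lerp w a t) /\ ~ V (lerp w a t) &
      forall t, 0 < t <= 1 -> ~ O (lerp w b t) /\ ~ U (lerp w b t)].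

Lemma sees_both_sym (U V O : set plane) : sees_both U V O -> sees_both V U O.
Proof. by move=> [w [a [b [*]]]]; exists w, b, a. Qed.

(** Let [t1] be the first blocked position of the endpoint sliding from [a0] to [a1], and [w] the
    hit nearest [b]. From [w] the view to [b] is free by the choice of [w]; towards U one looks at
    an earlier position, through the part of the triangle already swept. *)
Lemma sweep (U V O : set plane) a0 a1 b :
  closed V -> closed O -> convex_set2 U -> convex_set2 V ->
  U `&` O = set0 -> V `&` O = set0 -> U a0 -> U a1 -> V b ->
  (forall t, 0 <= t <= 1 -> ~ O (lerp b a0 t)) ->
  (exists2 t, 0 <= t <= 1 & O (lerp b a1 t)) -> sees_both U V O.
Proof.
move=> clV clO cU cV UO VO Ua0 Ua1 Vb free0 [l0 l001 Ol0].
have [|t1 [l1 [/[dup] t101 /andP[t10 t1_le1] l101 Ol1 mt1]]] :=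
    @cone_min b a0 a1 O fst clO (fun x => @cvg_fst _ _ _ _ _).
  by exists 1, l0; rewrite lerp1; split => //; lra.
have t1_gt0 : 0 < t1.
  rewrite lt_def t10 andbT; apply/eqP => t1E.
  by apply: (free0 l1) => //; move: Ol1; rewrite t1E lerp0.
set a' := lerp a0 a1 t1 in Ol1.
have Ua' : U a' by exact: convex_lerp.
(* The degenerate triangle [b a' a'] is the segment from [b] to [a']. *)
have [|t [l2 [_ /[dup] l201 /andP[l20 l2_le1]]]] :=
    @cone_min b a' a' O snd clO (fun x => @cvg_snd _ _ _ _ _).
  by exists 0, l1; rewrite lerpxx; split => //; lra.
rewrite lerpxx => Ow ml2; set w := lerp b a' l2 in Ow.
have l2_gt0 : 0 < l2.
  rewrite lt_def l20 andbT; apply/eqP => l2E.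
  by apply: (free0 0); rewrite ?lerp0; [lra | move: Ow; rewrite /w l2E lerp0].
have wV : ~ V w by move=> Vw; have : (V `&` O) w by []; rewrite VO.
have wU : ~ U w by move=> Uw; have : (U `&` O) w by []; rewrite UO.
(* A point of V between [w] and [a'] would put [w] in V by convexity, since [w] lies between that
   point and [b]. *)
have wa'V t3 m : 0 <= t3 <= 1 -> 0 <= m <= 1 -> V (lerp w (lerp a0 a' t3) m) -> t3 < 1.
  move=> t301 m01 Vm; case: (ltP t3 1) => // t31; case: wV.
  have {t31}t31 : t3 = 1 by lra.
  move: Vm; rewrite t31 lerp1 /w lerp_lerpl => /(convex_lerp_le cV Vb); apply=> //.
  by have : 0 <= m * (1 - l2) by [apply: mulr_ge0; lra]; lra.
(* The endpoint backs off from the blocked position just enough to keep V out of the view from w. *)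
have [t3 /andP[t30 t31] t3V] : exists2 t3, 0 <= t3 < 1 &
    forall m, 0 <= m <= 1 -> ~ V (lerp w (lerp a0 a' t3) m).
  case: (pselect (exists t s, [/\ 0 <= t <= 1, 0 <= s <= 1 &
      V (lerp w (lerp a0 a' t) s)])) => [/(cone_min clV (@opp_fst_continuous R))|nV].
    move=> [t2 [m2 [t201 m201 Vt2 mt2]]]; have t2_lt1 := wa'V _ _ t201 m201 Vt2.
    (* [t2 < 1] is the last position towards which V meets the segment from [w]; the midpoint of
       [t2] and 1 is beyond it. *)
    exists ((t2 + 1) / 2); first by lra.
    by move=> m m01 /(mt2 _ _ _ m01) /=; lra.
  by exists 0; [lra | move=> m m01 Vm; apply: nV; exists 0, m; split=> //; lra].
exists w, (lerp a0 a' t3), b; split=> //.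
- by apply: convex_lerp => //; lra.
- move=> m /andP[m0 m1]; split; last by apply: t3V; lra.
  have m1' : 0 <= 1 - m by lra.
  have t1' : 0 <= 1 - t1 by lra.
  have t3' : 0 <= 1 - t3 by lra.
  have -> : lerp w (lerp a0 a' t3) m = bary b a0 a1
      ((1 - m) * (l2 * (1 - t1)) + m * (1 - t3 * t1))
      ((1 - m) * (l2 * t1) + m * (t3 * t1)).
    by rewrite /w /a' /lerp /bary; congr pair => /=; ring.
  have p1 := mulr_ge0 m1' (mulr_ge0 l20 t1').
  have p2 := mulr_ge0 m1' (mulr_ge0 l20 t10).
  have p3 := mulr_ge0 (ltW m0) (mulr_ge0 t30 t10).
  have p4 := mulr_ge0 (ltW m0) (mulr_ge0 t10 t3').
  have p5 := mulr_ge0 (ltW m0) t1'.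
  have p6 : 0 <= (1 - m) * (1 - l2) by apply: mulr_ge0; lra.
  have [|||t' [s' [t'01 s'01 ex ey ->]]] := @bary_cone b a0 a1
      ((1 - m) * (l2 * (1 - t1)) + m * (1 - t3 * t1))
      ((1 - m) * (l2 * t1) + m * (t3 * t1)).
  - by lra.
  - by lra.
  - by lra.
  (* A point of O here would give [t1 <= t'], yet [s' * t'] falls short of [s' * t1] by
     [m * t1 * (1 - t3)]. *)
  move=> /(mt1 _ _ t'01 s'01) /= le_t.
  have s'E : s' = (1 - m) * l2 + m by lra.
  have s'0 : 0 <= s' by lra.
  have := ler_wpM2l s'0 le_t; rewrite ey {1}s'E.
  have : 0 < m * t1 * (1 - t3) by rewrite !mulr_gt0 //; lra.
  by lra.
- move=> m /andP[m0 m1].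
  have q1 : 0 < m * l2 by rewrite mulr_gt0.
  have q2 : 0 <= (1 - m) * l2 by apply: mulr_ge0; lra.
  have -> : lerp w b m = lerp b a' ((1 - m) * l2) by rewrite lerp_sym lerp_lerpr.
  split=> [Om|Um].
    have := ml2 0 ((1 - m) * l2); rewrite lerpxx /= => h.
    by have : l2 <= (1 - m) * l2 by [apply: h => //; lra]; lra.
  apply: wU; rewrite /w lerp_sym; move: Um; rewrite lerp_sym => Um.
  by apply: (convex_lerp_le cU Ua' Um); lra.
Qed.

(** [m r] is the minimum of [x + r y] over the part of U in the triangle. Testing a minimiser for
    [r] at [r'] changes the form by [(r' - r) y] with [0 <= y <= 1], whence the last bound. *)
Lemma support_value (U : set plane) p a b :
  closed U ->
  (exists t s, [/\ 0 <= t <= 1, 0 <= s <= 1 & U (lerp p (lerp a b t) s)]) ->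
  exists m t s : R -> R, forall r,
  [/\ 0 <= t r <= 1 /\ 0 <= s r <= 1, U (lerp p (lerp a b (t r)) (s r)),
      m r = s r * (1 - t r + r * t r),
      forall t' s', 0 <= t' <= 1 -> 0 <= s' <= 1 -> U (lerp p (lerp a b t') s') ->
        m r <= s' * (1 - t' + r * t') &
      forall r', m r' - m r <= `|r' - r|].
Proof.
move=> clU exU.
have /choice[x xP] : forall r, exists x : R * R,
    [/\ 0 <= x.1 <= 1, 0 <= x.2 <= 1, U (lerp p (lerp a b x.1) x.2) &
     forall t s, 0 <= t <= 1 -> 0 <= s <= 1 -> U (lerp p (lerp a b t) s) ->
        x.2 * (1 - x.1 + r * x.1) <= s * (1 - t + r * t)].
  move=> r; have [t [s [? ? ? mts]]] := cone_min clU (@weight_continuous R r) exU.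
  by exists (t, s); split.
exists (fun r => (x r).2 * (1 - (x r).1 + r * (x r).1)).
exists (fun r => (x r).1), (fun r => (x r).2) => r.
have [t01 s01 Ux mx] := xP r; split=> // r'.
have [_ _ _ /(_ _ _ t01 s01 Ux) mx'] := xP r'.
move: t01 s01 => /andP[t0 t1] /andP[s0 s1].
apply: le_trans (_ : (r' - r) * ((x r).2 * (x r).1) <= _); first by lra.
apply: le_trans (ler_norm _) _; rewrite normrM ler_piMr // ger0_norm ?mulr_ge0 //.
by rewrite mulr_ile1.
Qed.

(* Common supporting line x + r y = c of the parts of U and V in the triangle p a b: the minima
   of x + r y over the two parts compare in opposite ways at r = 0 and at large r. *)
Lemma bitangent (U V : set plane) p a b :
  closed U -> closed V -> U a -> V b ->
  (forall t, 0 <= t <= 1 -> ~ V (lerp p a t)) ->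
  (forall t, 0 <= t <= 1 -> ~ U (lerp p b t)) ->
  exists r c t1 s1 t2 s2, [/\ 0 < c,
    [/\ 0 <= t1 <= 1, 0 <= s1 <= 1, U (lerp p (lerp a b t1) s1) & s1 * (1 - t1 + r * t1) = c],
    [/\ 0 <= t2 <= 1, 0 <= s2 <= 1, V (lerp p (lerp a b t2) s2) & s2 * (1 - t2 + r * t2) = c] &
    forall t s, 0 <= t <= 1 -> 0 <= s <= 1 ->
      U (lerp p (lerp a b t) s) \/ V (lerp p (lerp a b t) s) -> c <= s * (1 - t + r * t)].
Proof.
move=> clU clV Ua Vb aV bU.
have exU : exists t s, [/\ 0 <= t <= 1, 0 <= s <= 1 & U (lerp p (lerp a b t) s)].
  by exists 0, 1; rewrite lerp0 lerp1; split=> //; lra.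
have exV : exists t s, [/\ 0 <= t <= 1, 0 <= s <= 1 & V (lerp p (lerp a b t) s)].
  by exists 1, 1; rewrite !lerp1; split=> //; lra.
have [mU [tU [sU UP]]] := support_value clU exU.
have [mV [tV [sV VP]]] := support_value clV exV.
(* U misses the side [pb] and V the side [pa], so [x > 0] on U and [y > 0] on V. *)
have Upos t s : 0 <= t <= 1 -> 0 <= s <= 1 -> U (lerp p (lerp a b t) s) -> 0 < s * (1 - t).
  move=> t01 s01 Uts; rewrite mulr_gt0 // ?subr_gt0 lt_def; apply/andP; split; try lra;
    apply/eqP => E; move: Uts.
    by rewrite E lerp0 -(lerp0 p b); apply: bU; lra.
  by rewrite -E lerp1; exact: bU.
have Vpos t s : 0 <= t <= 1 -> 0 <= s <= 1 -> V (lerp p (lerp a b t) s) -> 0 < t * s.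
  move=> t01 s01 Vts; rewrite mulr_gt0 // lt_def; apply/andP; split; try lra;
    apply/eqP => E; move: Vts.
    by rewrite E lerp0; exact: aV.
  by rewrite E lerp0 -(lerp0 p a); apply: aV; lra.
have [t0 [s0 [t001 s001 V0 m0]]] := cone_min clV (@fst_snd_continuous R) exV.
have {V0} := Vpos _ _ t001 s001 V0; set d := t0 * s0 in m0 * => d0.
(* At [r = 0] the point [b] gives V the value 0, while U stays positive. As [d] is the least [y] on
   V, at [r = d^-1] the form is at least 1 on V and equals 1 at [a] in U. The constant 2 adds the
   two Lipschitz constants. *)
have [||||r r0 /= rE] := @lipschitz_IVT R (fun r => mV r - mU r) 0 d^-1 2.
- move=> x y; have [_ _ _ _ /(_ x)] := VP y; have [_ _ _ _ /(_ y)] := UP x.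
  by rewrite (distrC y x); lra.
- by rewrite invr_ge0 ltW.
- have [[t01 s01] /(Upos _ _ t01 s01) U0 E _ _] := UP 0.
  have [_ _ _ /(_ 1 1) h _] := VP 0.
  by move: h; rewrite !lerp1 => /(_ _ _ Vb) h; rewrite E; move: (h ltac:(lra) ltac:(lra)); lra.
- have [[t01 s01] VV E _ _] := VP d^-1.
  have [_ _ _ /(_ 0 1) h _] := UP d^-1.
  move: h; rewrite lerp0 lerp1 => /(_ _ _ Ua) h; move: (h ltac:(lra) ltac:(lra)) => {}h.
  have /= := m0 _ _ t01 s01 VV; move: t01 s01 => /andP[? ?] /andP[? ?] dle.
  have : 1 <= d^-1 * (tV d^-1 * sV d^-1) by rewrite mulrC ler_pdivlMr ?mul1r.
  have : 0 <= sV d^-1 * (1 - tV d^-1) by apply: mulr_ge0; lra.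
  move=> k1 k2; rewrite subr_ge0 E; apply: le_trans h _; move: k1 k2.
  by move: d^-1 (sV d^-1) (tV d^-1) => ? ? ?; lra.
have [[tU01 sU01] UU EU minU _] := UP r; have [[tV01 sV01] VV EV minV _] := VP r.
have mE : mV r = mU r by lra.
exists r, (mU r), (tU r), (sU r), (tV r), (sV r); split.
- rewrite EU; have := Upos _ _ tU01 sU01 UU.
  move: tU01 sU01 => /andP[? _] /andP[? _].
  by have : 0 <= sU r * (r * tU r) by [rewrite !mulr_ge0]; lra.
- by split.
- by split; rewrite // -mE.
- by move=> t s t01 s01 [/minU|/minV]; rewrite ?mE; apply.
Qed.

(** Inside the triangle on [w] and the tangent points [a], [b], the supporting form is below [c] off
    the side [ab], which excludes U and V; beyond the point of O closest to [ab] there is no O. *)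
Lemma common_view (U V O : set plane) w a0 b0 :
  closed U -> closed V -> closed O ->
  U `&` V = set0 ->
  (forall a b t, U a -> V b -> 0 <= t <= 1 -> ~ O (lerp a b t)) ->
  O w -> U a0 -> V b0 ->
  (forall t, 0 <= t <= 1 -> ~ V (lerp w a0 t)) ->
  (forall t, 0 <= t <= 1 -> ~ U (lerp w b0 t)) -> sees_both U V O.
Proof.
move=> clU clV clO UV free Ow Ua0 Vb0 aV bU.
have [r [c [t1 [s1 [t2 [s2 [c0 [t101 s101 Ua aE] [t201 s201 Vb bE] minc]]]]]]] :=
  bitangent clU clV Ua0 Vb0 aV bU.
set a := lerp w (lerp a0 b0 t1) s1 in Ua; set b := lerp w (lerp a0 b0 t2) s2 in Vb.
have [|l [s [/andP[l0 l1] /andP[s0 s_le1] Ow' ms]]] :=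
    @cone_min w a b O _ clO (@opp_snd_continuous R).
  by exists 0, 0; split; rewrite ?lerp0 //; lra.
have s_lt1 : s < 1.
  case: (ltP s 1) => // s_ge1; case: (free a b l Ua Vb); first by lra.
  by move: Ow'; have -> : s = 1 by [lra]; rewrite lerp1.
have notO x y : 0 <= x -> 0 <= y -> s < x + y -> x + y <= 1 -> ~ O (bary w a b x y).
  move=> x0 y0 sxy xy1; have [t' [s' [t'01 s'01 ex ey ->]]] := @bary_cone w a b x y x0 y0 xy1.
  by move=> /(ms _ _ t'01 s'01) /=; lra.
have notUV x y : 0 <= x -> 0 <= y -> x + y < 1 -> ~ U (bary w a b x y) /\ ~ V (bary w a b x y).
  move=> x0 y0 xy1.
  have k1 : 0 <= x * (s1 * (1 - t1)) by apply: mulr_ge0 x0 (mulr_ge0 _ _); lra.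
  have k2 : 0 <= x * (s1 * t1) by apply: mulr_ge0 x0 (mulr_ge0 _ _); lra.
  have k3 : 0 <= y * (s2 * (1 - t2)) by apply: mulr_ge0 y0 (mulr_ge0 _ _); lra.
  have k4 : 0 <= y * (s2 * t2) by apply: mulr_ge0 y0 (mulr_ge0 _ _); lra.
  have k5 : 0 <= x * (1 - s1) by apply: mulr_ge0 x0 _; lra.
  have k6 : 0 <= y * (1 - s2) by apply: mulr_ge0 y0 _; lra.
  rewrite /a /b !cone_bary bary_bary.
  have [|||t' [s' [t'01 s'01 ex ey ->]]] := @bary_cone w a0 b0
      (x * (s1 * (1 - t1)) + y * (s2 * (1 - t2))) (x * (s1 * t1) + y * (s2 * t2)).
  - by lra.
  - by lra.
  - by lra.
  (* The form vanishes at [w] and equals [c] at [a] and [b]. *)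
  have gE : s' * (1 - t' + r * t') = (x + y) * c.
    have -> : s' * (1 - t' + r * t') = s' * (1 - t') + r * (s' * t') by ring.
    rewrite ex ey mulrDl -{1}aE -bE; ring.
  have lt : s' * (1 - t' + r * t') < c by rewrite gE gtr_pMl.
  by split=> ?; move: lt; rewrite ltNge minc //; [left|right].
exists (lerp w (lerp a b l) s), a, b.
have q1 : 0 <= s * (1 - l) by apply: mulr_ge0; lra.
have q2 : 0 <= s * l by apply: mulr_ge0.
split=> // t /andP[t0 t1'].
- have e : lerp (lerp w (lerp a b l) s) a t = bary w a b ((1 - t) * (s * (1 - l)) + t) ((1 - t) * (s * l)).
    by rewrite /lerp /bary; congr pair => /=; ring.
  have p1 : 0 <= (1 - t) * (s * (1 - l)) by apply: mulr_ge0 _ q1; lra.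
  have p2 : 0 <= (1 - t) * (s * l) by apply: mulr_ge0 _ q2; lra.
  have p3 : 0 < t * (1 - s) by apply: mulr_gt0 => //; lra.
  have p4 : 0 <= (1 - t) * (1 - s) by apply: mulr_ge0; lra.
  split; first by rewrite e; apply: notO; lra.
  have [->|t_neq1] := eqVneq t 1.
    by rewrite lerp1 => Va; have : (U `&` V) a by []; rewrite UV.
  have p5 : 0 < (1 - t) * (1 - s) by apply: mulr_gt0; rewrite subr_gt0 // lt_neqAle t_neq1.
  by rewrite e; apply: (notUV _ _ _ _ _).2; lra.
- have e : lerp (lerp w (lerp a b l) s) b t = bary w a b ((1 - t) * (s * (1 - l))) ((1 - t) * (s * l) + t).
    by rewrite /lerp /bary; congr pair => /=; ring.
  have p1 : 0 <= (1 - t) * (s * (1 - l)) by apply: mulr_ge0 _ q1; lra.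
  have p2 : 0 <= (1 - t) * (s * l) by apply: mulr_ge0 _ q2; lra.
  have p3 : 0 < t * (1 - s) by apply: mulr_gt0 => //; lra.
  have p4 : 0 <= (1 - t) * (1 - s) by apply: mulr_ge0; lra.
  split; first by rewrite e; apply: notO; lra.
  have [->|t_neq1] := eqVneq t 1.
    by rewrite lerp1 => Ub; have : (U `&` V) b by []; rewrite UV.
  have p5 : 0 < (1 - t) * (1 - s) by apply: mulr_gt0; rewrite subr_gt0 // lt_neqAle t_neq1.
  by rewrite e; apply: (notUV _ _ _ _ _).1; lra.
Qed.

(** * From the geometry to the graph *)

Lemma plane_hausdorff : hausdorff_space plane.
Proof. exact: (@norm_hausdorff R (R^o * R^o)%type). Qed.

Theorem theorem1 (T : finType) (e : rel T) :
  symmetric e -> irreflexive e ->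
  convex_compact_visibility_graph e ->
  forall u v : T, e u v ->
    is_bridge e u v \/ exists w : T, e u w && e v w.
Proof.
move=> se ie [reg [ne [_ [cpt [cvx [dis adj]]]]]] u v euv.
have neq x y : e x y -> x != y by apply: contraTneq => ->; rewrite ie.
have neq_uv := neq _ _ euv.
have clreg z : closed (reg z).
  by apply: compact_closed (cpt z); exact: plane_hausdorff.
have disj x y p : x != y -> reg x p -> ~ reg y p.
  by move=> xy xp yp; have : (reg x `&` reg y) p by []; rewrite dis.
have sight x y : e x y -> exists a b, [/\ reg x a, reg y b &
    forall z t, z != x -> z != y -> 0 <= t <= 1 -> ~ reg z (lerp a b t)].
  move=> exy; have [a [b [xa [yb ab]]]] := (adj _ _ (neq _ _ exy)).1 exy.
  exists a, b; split=> // z t zx zy t01 zt.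
  by have : (segment a b `&` reg z) (lerp a b t) by [split=> //; exists t]; rewrite ab.
pose O := \bigcup_(z in [set z | z != u /\ z != v]) reg z.
have clO : closed O by apply: closed_bigcup => //; exact: finite_finset.
have notO z p : z != u -> z != v -> ~ O p -> ~ reg z p.
  by move=> zu zv nO zp; apply: nO; exists z.
have UV := dis _ _ neq_uv.
have UO : reg u `&` O = set0.
  by apply/seteqP; split=> // p [up [z [zu _]]]; apply: disj up; rewrite eq_sym.
have VO : reg v `&` O = set0.
  by apply/seteqP; split=> // p [vp [z [_ zv]]]; apply: disj vp; rewrite eq_sym.
have [[w [a [b [[z [zu zv] zw] ua vb wa wb]]]]|nosee] :=
    pselect (sees_both (reg u) (reg v) O).
  right; exists z.
  have view x y c : x != z -> reg x c ->
      (forall p, ~ O p -> ~ reg y p -> forall z', z' != z -> z' != x -> ~ reg z' p) ->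
      (forall t, 0 < t <= 1 -> ~ O (lerp w c t) /\ ~ reg y (lerp w c t)) -> e x z.
    move=> xz xc only wc; rewrite se; apply/(adj _ _ _).2; first by rewrite eq_sym.
    exists w, c; split=> //; split=> // z' z'z z'x.
    apply/seteqP; split=> // p [[t [/andP[t0 t1] ->]]] /=; rewrite -/(lerp w c t).
    have [->|t_neq0] := eqVneq t 0; first by rewrite lerp0; apply: disj zw; rewrite eq_sym.
    have [|nO ny] := wc t; first by rewrite lt_def t_neq0 t0.
    exact: only.
  apply/andP; split.
    apply: (view u v a) wa => //; first by rewrite eq_sym.
    move=> p nO nv z' _ z'u; have [->//|z'v] := eqVneq z' v; exact: notO.
  apply: (view v u b) wb => //; first by rewrite eq_sym.
  move=> p nO nu z' _ z'v; have [->//|z'u] := eqVneq z' u; exact: notO.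
left.
have free a b t : reg u a -> reg v b -> 0 <= t <= 1 -> ~ O (lerp a b t).
  have [a1 [b1 [ua1 vb1 free1]]] := sight _ _ euv.
  (* Freeness spreads from one sightline in two sweeps: over U with [b1] fixed, then over V with any
     point of U fixed. *)
  have free2 a' t' : reg u a' -> 0 <= t' <= 1 -> ~ O (lerp a' b1 t').
    move=> ua' t'01; rewrite lerp_sym => Oa'; apply: nosee.
    apply: (@sweep _ _ _ a1 a' b1) => //; last by exists (1 - t'); first lra.
    move=> t'' t''01; rewrite lerp_sym => -[z [zu zv]].
    by apply: free1 => //; lra.
  move=> ua vb t01 Oab; apply/nosee/sees_both_sym.
  by apply: (@sweep _ _ _ b1 b a) => //; [move=> *; exact: free2 | exists t].
(* [behind u v] means behind U, and [behind v u] behind V. *)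
pose behind x y p := forall b, reg y b -> exists2 t, 0 <= t <= 1 & reg x (lerp p b t).
have dich p : O p -> behind u v p \/ behind v u p.
  move=> Op; apply: contrapT => /not_orP[/existsNP[b /not_implyP[vb nb]]].
  move=> /existsNP[a /not_implyP[ua na]]; apply: nosee.
  apply: (@common_view _ _ _ p a b) => //.
    by move=> t t01 vt; apply: na; exists t.
  by move=> t t01 ut; apply: nb; exists t.
have cross p q : behind u v p -> behind v u q ->
    ~ (forall t, 0 <= t <= 1 -> ~ reg v (lerp p q t)).
  by have [b vb] := ne v; move=> pu qv pq; exact: (behind_crossing (clreg v) UV vb pu qv pq).
(* Otherwise a segment inside the region of [z], hence missing V, would contradict [cross]; so one
   point decides for its whole region. *)
have same z p q : z != u -> z != v -> reg z p -> reg z q -> behind u v p -> behind u v q.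
  move=> zu zv zp zq pu; have [//|qv] : behind u v q \/ behind v u q.
    by apply: dich; exists z.
  case: (cross p q pu qv) => t t01; apply: (disj z) => //; exact: convex_lerp.
pose S z := `[< z = u \/ [/\ z != u, z != v & exists2 p, reg z p & behind u v p] >].
apply: (@bridge_of_cut _ _ S) => //; first by apply/asboolP; left.
  by apply/asboolP => -[vu|[]]; [rewrite vu eqxx in neq_uv | rewrite eqxx].
move=> x y exy /asboolP Sx /asboolP Sy.
have [yu|yu] := eqVneq y u; first by case: Sy; left.
have behindV q : y != v -> reg y q -> behind v u q.
  move=> yv yq; have [qu|//] : behind u v q \/ behind v u q by apply: dich; exists y.
  by case: Sy; right; split=> //; exists q.
have [p [q [xp yq pq]]] := sight _ _ exy.
(* A sightline leaving [S], other than one for [uv], is blocked: by V if it starts in U, by U if it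
   ends in V, and by V through [cross] in the remaining case. *)
case: Sx => [xu|[xu xv [p' xp' p'u]]].
  split=> //; apply/eqP/negPn/negP => yv; rewrite {}xu in xp pq.
  have [t t01 vt] := behindV q yv yq p xp; apply: (pq v (1 - t)) => //.
  - by rewrite eq_sym.
  - by rewrite eq_sym.
  - by lra.
  - by rewrite -lerp_sym.
have pu := same _ _ _ xu xv xp' xp p'u.
have [yv|yv] := eqVneq y v.
  rewrite yv in yq pq; have [t t01 ut] := pu q yq.
  by case: (pq u t) => //; rewrite eq_sym.
by case: (cross p q pu (behindV q yv yq)) => t t01; apply: pq; rewrite // eq_sym.
Qed.
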